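(* Let $(A,\Phi)$ be an $\ell$CEDS and $\mathcal{D}$ a set. Let $T,T'$ be two $A$-typed and $\mathcal{D}$-decorated rooted trees and let $a\in A$. Then, in $\mathfrak{g}_{A,\mathcal{D}}$, $$T\circ_a T'=\sum_{x\in V(T')}T\diamond_{\Phi,a}^{(x)}T',$$ where $V(T')$ is the set of vertices of $T'$.
   Context: $\mathbb{K}$ is a field of characteristic zero and all vector spaces are over $\mathbb{K}$; $\tau$ is the flip of $A\otimes A$. An $\ell$CEDS is a pair $(A,\Phi)$ with $A$ a vector space and $\Phi:A\otimes A\to A\otimes A$ linear such that $(\mathrm{Id}\otimes\Phi)\circ(\Phi\otimes\mathrm{Id})\circ(\mathrm{Id}\otimes\Phi)=(\Phi\otimes\mathrm{Id})\circ(\mathrm{Id}\otimes\tau)\circ(\Phi\otimes\mathrm{Id})$ and $(\mathrm{Id}\otimes\Phi)\circ(\mathrm{Id}\otimes\tau)\circ(\tau\otimes\mathrm{Id})\circ(\Phi\otimes\mathrm{Id})=(\tau\otimes\mathrm{Id})\circ(\Phi\otimes\mathrm{Id})\circ(\mathrm{Id}\otimes\Phi)\circ(\mathrm{Id}\otimes\tau)$. Formal Sweedler notation: $\Phi(a\otimes b)=\sum a'\rightarrow b'\otimes a''\triangleright b''$. An $A$-typed and $\mathcal{D}$-decorated rooted tree is a (non-planar) rooted tree whose vertices are decorated by elements of $\mathcal{D}$ and whose edges are typed by elements of $A$; $\mathfrak{g}_{A,\mathcal{D}}$ is the vector space generated by them, trees being linear in the type of each edge. $B_d(a_1T_1,\ldots,a_kT_k)$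 is the tree obtained by grafting $T_1,\ldots,T_k$ on a common root decorated by $d$, the edge from the root to the root of $T_i$ being of type $a_i$ (extended multilinearly; for $k=0$ it is the single vertex decorated by $d$). The products $\circ_a$ on $\mathfrak{g}_{A,\mathcal{D}}$ ($a\in A$) are defined inductively by $$T\circ_a B_d(a_1T_1,\ldots,a_kT_k)=B_d(aT,a_1T_1,\ldots,a_kT_k)+\sum_{i=1}^k\sum B_d(a_1T_1,\ldots,(a'\rightarrow a_i')(T\circ_{a''\triangleright a_i''}T_i),\ldots,a_kT_k).$$ For a vertex $x$ of $T'$, $T\diamond_{\Phi,a}^{(x)}T'\in\mathfrak{g}_{A,\mathcal{D}}$ is obtained as follows. Graft $T$ on the vertex $x$ of $T'$; this adds an edge $e$, from $x$ to the root of $T$, of type $a$. Let $e_1,\ldots,e_k$ be the edges of $T'$ on the path from the root of $T'$ to $x$ (in this order, starting from the root), with types $a_1,\ldots,a_k$. Compute $$\sum_{i=1}^p a'_{1,i}\otimes\cdots\otimes a'_{k,i}\otimes a'_i=(\mathrm{Id}^{\otimes(k-1)}\otimes\Phi)\circ(\mathrm{Id}^{\otimes(k-2)}\otimes\Phi\otimes\mathrm{Id})\circ\cdots\circ(\Phi\otimes\mathrm{Id}^{\otimes(k-1)})(a\otimes a_1\otimes\cdots\otimes a_k)$$ and take the sum over $1\leq i\leq p$ of the trees obtained by typing $e$ by $a'_i$ and $e_j$ by $a'_{j,i}$ for each $j$ (all other types unchanged). If $k=0$, $e$ has type $a$. *)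

(* Defs.v *)
From HB Require Import structures.
From mathcomp Require Import all_boot all_algebra.
From mathcomp Require Import boolp.
From mathcomp Require Import freeg.

Set Implicit Arguments.
Unset Strict Implicit.
Unset Printing Implicit Defensive.

Import GRing.Theory.
Local Open Scope ring_scope.
Local Open Scope quotient_scope.

Section LinearFacts.
Variables (K : fieldType) (U V : lmodType K) (f : U -> V).
Hypothesis lf : linear f.

Lemma lin0 : f 0 = 0.
Proof. by have := lf (-1) 0 0; rewrite scaler0 addr0 scaleN1r addNr. Qed.
Lemma linD u v : f (u + v) = f u + f v.
Proof. by have := lf 1 u v; rewrite !scale1r. Qed.
Lemma linZ c u : f (c *: u) = c *: f u.
Proof. by have := lf c u 0; rewrite !addr0 lin0 addr0. Qed.
Lemma linB u v : f (u - v) = f u - f v.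
Proof. by rewrite -scaleN1r linD linZ scaleN1r. Qed.

End LinearFacts.

(* [presented R] is the vector space with generators [X] and relations [r = 0]
   for [r] in [R]: the free vector space on [X] modulo the span of [R]. *)
Section Presented.
Variables (K : fieldType) (X : choiceType) (R : {freeg X / K} -> Prop).

Inductive span : {freeg X / K} -> Prop :=
| span_nil : span 0
| span_cons c r u : R r -> span u -> span (c *: r + u).

Definition span_pred : {pred {freeg X / K}} := fun u => `[< span u >].

Lemma spanD u v : span u -> span v -> span (u + v).
Proof.
elim=> [|c r {}u Rr _ IH] sv; first by rewrite add0r.
by rewrite -addrA; apply: span_cons => //; exact: IH.
Qed.

Lemma spanZ c u : span u -> span (c *: u).
Proof.
elim=> [|c' r {}u Rr _ IH]; first by rewrite scaler0; exact: span_nil.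
by rewrite scalerDr scalerA; exact: span_cons.
Qed.

Fact span_closed : zmod_closed span_pred.
Proof.
split=> [|u v /asboolP su /asboolP sv]; apply/asboolP; first exact: span_nil.
by apply: spanD => //; rewrite -scaleN1r; exact: spanZ.
Qed.
HB.instance Definition _ := GRing.isZmodClosed.Build _ span_pred span_closed.

Definition presented := Quotient.quot span_pred.
HB.instance Definition _ := GRing.Zmodule.on presented.
HB.instance Definition _ := EqQuotient.on presented.

Definition pclass (u : {freeg X / K}) : presented := \pi_(Quotient.quot span_pred) u.

Lemma pclassP u v : pclass u = pclass v <-> span (u - v).
Proof.
split=> [/eqP|/asboolP h]; last by apply/eqP; rewrite eqmodE.
by rewrite eqmodE => /asboolP.
Qed.

Lemma pclassK x : pclass (repr x) = x.
Proof. exact: reprK. Qed.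

Lemma pclassD u v : pclass (u + v) = pclass u + pclass v.
Proof. exact: (Quotient.pi_add span_pred u v). Qed.

Definition pscale c (x : presented) : presented := pclass (c *: repr x).

Lemma pscale_pclass c u : pscale c (pclass u) = pclass (c *: u).
Proof.
by apply/pclassP; rewrite -scalerBr; apply: spanZ; apply/pclassP; exact: pclassK.
Qed.

Fact pscaleA a b x : pscale a (pscale b x) = pscale (a * b) x.
Proof. by rewrite -[x]pclassK !pscale_pclass scalerA. Qed.
Fact pscale1 : left_id 1 pscale.
Proof. by move=> x; rewrite -[x]pclassK pscale_pclass scale1r. Qed.
Fact pscaleDr : right_distributive pscale +%R.
Proof.
by move=> c x y; rewrite -[x]pclassK -[y]pclassK -pclassD !pscale_pclass scalerDr pclassD.
Qed.
Fact pscaleDl x : {morph pscale^~ x : a b / a + b}.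
Proof. by move=> a b; rewrite -[x]pclassK !pscale_pclass scalerDl pclassD. Qed.
HB.instance Definition _ :=
  GRing.Zmodule_isLmodule.Build K presented pscaleA pscale1 pscaleDr pscaleDl.

Lemma pclassZ c u : pclass (c *: u) = c *: pclass u.
Proof. by rewrite -pscale_pclass. Qed.

Definition pgen (x : X) : presented := pclass << x >>.

(* The linear extension of [f : X -> V]: write an element of [presented R] as a
   linear combination of generators and apply [f] termwise. The result does not
   depend on the chosen expression, and is linear, as soon as [f] is compatible
   with the relations ([respects f]), which is proved below for every use. *)
Definition plift (V : lmodType K) (f : X -> V) (x : presented) : V :=
  fglift f (repr x).

Definition respects (V : lmodType K) (f : X -> V) :=
  forall r, R r -> fglift f r = 0.

Lemma fglift_lin (V : lmodType K) (f : X -> V) : linear (fglift f).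
Proof.
pose f' := HB.pack_for {additive {freeg X / K} -> V} (fglift f)
  (GRing.isZmodMorphism.Build _ _ (fglift f) (lift_is_additive f)).
move=> c u v.
have fD : {morph fglift f : a b / a + b} by exact: (raddfD f').
have fsum (I : Type) (r : seq I) F :
    fglift f (\sum_(i <- r) F i) = \sum_(i <- r) fglift f (F i)
  by exact: (raddf_sum f').
rewrite fD; congr (_ + _).
have [s ->] : exists s : seq (K * X), u = \sum_(p <- s) << p.1 *g p.2 >>.
  by exists [seq (coeff x u, x) | x <- dom u]; rewrite big_map freeg_sumE.
rewrite scaler_sumr !fsum scaler_sumr; apply: eq_bigr => -[k x] _ /=.
rewrite liftU scalerA -(liftU f); congr (fglift f _).
by apply/eqP/freeg_eqP => y; rewrite coeffZ !coeffU mulrA.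
Qed.

Lemma fglift_gen (V : lmodType K) (f : X -> V) x : fglift f << x >> = f x.
Proof. by rewrite liftU scale1r. Qed.

Lemma free_ind (P : {freeg X / K} -> Prop) :
  P 0 -> (forall c x u, P u -> P (c *: << x >> + u)) -> forall u, P u.
Proof.
move=> P0 PS; elim/freeg_ind_dom0 => // k x u _ _ Pu.
suff -> : << k *g x >> = k *: << x >> :> {freeg X / K} by exact: PS.
by apply/eqP/freeg_eqP => y; rewrite coeffZ !coeffU mul1r.
Qed.

Lemma fglift_comp (V W : lmodType K) (L : V -> W) (f : X -> V) u :
  linear L -> L (fglift f u) = fglift (fun x => L (f x)) u.
Proof.
move=> lL; elim/free_ind: u => [|c x u IH].
  by rewrite !(lin0 (fglift_lin _)) lin0.
by rewrite !fglift_lin !fglift_gen lL IH.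
Qed.

Lemma fglift_linfun (V : lmodType K) c (f g : X -> V) u :
  fglift (fun x => c *: f x + g x) u = c *: fglift f u + fglift g u.
Proof.
elim/free_ind: u => [|b x u IH].
  by rewrite !(lin0 (fglift_lin _)) scaler0 addr0.
rewrite !fglift_lin !fglift_gen IH !scalerDr !scalerA mulrC.
by rewrite -!addrA; congr (_ + _); rewrite addrCA.
Qed.

Lemma plift_comp (V W : lmodType K) (L : V -> W) (f : X -> V) u :
  linear L -> L (plift f u) = plift (fun x => L (f x)) u.
Proof. exact: fglift_comp. Qed.

Lemma plift_linfun (V : lmodType K) c (f g : X -> V) u :
  plift (fun x => c *: f x + g x) u = c *: plift f u + plift g u.
Proof. exact: fglift_linfun. Qed.

Lemma plift_pclass (V : lmodType K) (f : X -> V) u :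
  respects f -> plift f (pclass u) = fglift f u.
Proof.
move=> rf; apply/eqP; rewrite -subr_eq0 /plift -(linB (fglift_lin _)).
have /pclassP : pclass (repr (pclass u)) = pclass u by exact: pclassK.
elim=> [|c r v Rr _ /eqP IH]; first by rewrite (lin0 (fglift_lin _)).
by rewrite fglift_lin rf // scaler0 add0r IH.
Qed.

Lemma plift_gen (V : lmodType K) (f : X -> V) x :
  respects f -> plift f (pgen x) = f x.
Proof. by move=> rf; rewrite plift_pclass // fglift_gen. Qed.

Lemma plift_lin (V : lmodType K) (f : X -> V) : respects f -> linear (plift f).
Proof.
move=> rf c x y; rewrite -[x]pclassK -[y]pclassK -pclassZ -pclassD.
by rewrite !plift_pclass // fglift_lin.
Qed.

Lemma pclass_lin : linear pclass.
Proof. by move=> c u v; rewrite pclassD pclassZ. Qed.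

Lemma pclass_rel r : R r -> pclass r = 0.
Proof.
move=> Rr; rewrite -(lin0 pclass_lin); apply/pclassP; rewrite subr0.
by rewrite -[r]scale1r -[_ *: _]addr0; apply: span_cons => //; exact: span_nil.
Qed.

Lemma pclass_fglift u : pclass u = fglift pgen u.
Proof.
elim/free_ind: u => [|c x u IH]; first by rewrite !(lin0 pclass_lin) !(lin0 (fglift_lin _)).
by rewrite pclass_lin fglift_lin fglift_gen IH.
Qed.

Lemma pgen_respects : respects pgen.
Proof. by move=> r Rr; rewrite -pclass_fglift pclass_rel. Qed.

Lemma presented_ind (P : presented -> Prop) :
  P 0 -> (forall c x u, P u -> P (c *: pgen x + u)) -> forall u, P u.
Proof.
move=> P0 PS u; rewrite -[u]pclassK; elim/free_ind: {u}(repr u) => [|c x u Pu].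
  by rewrite (lin0 pclass_lin).
by rewrite pclass_lin; exact: PS.
Qed.

Lemma eq_lin (V : lmodType K) (f g : presented -> V) :
  linear f -> linear g -> (forall x, f (pgen x) = g (pgen x)) -> f =1 g.
Proof.
move=> lf lg fg; elim/presented_ind => [|c x u IH]; first by rewrite !lin0.
by rewrite lf lg fg IH.
Qed.

Lemma plift_pgen u : plift pgen u = u.
Proof. by rewrite /plift -pclass_fglift pclassK. Qed.

End Presented.

Arguments pgen {K X R} x.

Section TensorPower.
Variables (K : fieldType) (A : lmodType K).

Definition tset n (v : n.-tuple A) (i : 'I_n) (a : A) : n.-tuple A :=
  [tuple if j == i then a else tnth v j | j < n].

Variant multilinear_rel n : {freeg (n.-tuple A) / K} -> Prop :=
| MultilinearRel v i c a b :
    multilinear_rel (<< tset v i (c *: a + b) >>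
                     - (c *: << tset v i a >> + << tset v i b >>)).

Definition tpow n := presented (@multilinear_rel n).
HB.instance Definition _ n := GRing.Lmodule.on (tpow n).

Definition pure n (v : n.-tuple A) : tpow n := pgen v.

Definition tens (a b : A) : tpow 2 := pure [tuple a; b].

Definition multilinear n (V : lmodType K) (f : n.-tuple A -> V) :=
  forall v i, linear (fun a => f (tset v i a)).

Lemma multilinearP n (V : lmodType K) (f : n.-tuple A -> V) :
  multilinear f -> respects (@multilinear_rel n) f.
Proof.
move=> mf _ [v i c a b].
by rewrite (linB (fglift_lin _)) fglift_lin !fglift_gen mf subrr.
Qed.

Lemma pure_multilinear n : multilinear (@pure n).
Proof.
move=> v i c a b; apply/eqP; rewrite -subr_eq0; apply/eqP.
have := pclass_rel (MultilinearRel v i c a b).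
by rewrite (linB (@pclass_lin _ _ _)) pclass_lin.
Qed.

Lemma tset_tset n (v : n.-tuple A) i a b : tset (tset v i a) i b = tset v i b.
Proof. by apply: eq_from_tnth => j; rewrite !tnth_mktuple; case: eqP. Qed.

Lemma tset_id n (v : n.-tuple A) i : tset v i (tnth v i) = v.
Proof. by apply: eq_from_tnth => j; rewrite !tnth_mktuple; case: eqP => [->|]. Qed.

Lemma bilinearP (V : lmodType K) (h : A -> A -> V) :
  (forall b, linear (h^~ b)) -> (forall a, linear (h a)) ->
  multilinear (fun w : 2.-tuple A => h (tnth w 0) (tnth w 1)).
Proof.
move=> hl hr w [[|[|//]] lti] c a b; rewrite !tnth_mktuple -!val_eqE /=.
- exact: hl.
- exact: hr.
Qed.

Lemma tset2l (a b c : A) : tset [tuple a; b] 0 c = [tuple c; b].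
Proof.
by apply: eq_from_tnth => -[[|[|//]] lti]; rewrite tnth_mktuple -val_eqE !(tnth_nth a).
Qed.

Lemma tset2r (a b c : A) : tset [tuple a; b] 1 c = [tuple a; c].
Proof.
by apply: eq_from_tnth => -[[|[|//]] lti]; rewrite tnth_mktuple -val_eqE !(tnth_nth a).
Qed.

Lemma tens_linl b : linear (tens^~ b).
Proof. by move=> c u v; have := @pure_multilinear 2 [tuple 0; b] 0 c u v; rewrite !tset2l. Qed.

Lemma tens_linr a : linear (tens a).
Proof. by move=> c u v; have := @pure_multilinear 2 [tuple a; 0] 1 c u v; rewrite !tset2r. Qed.

Definition flip : tpow 2 -> tpow 2 :=
  plift (fun w : 2.-tuple A => tens (tnth w 1) (tnth w 0)).

(* [act f i] is Id^(i) (x) f (x) Id^(k-1-i) on the (k+1)-st tensor power: [f]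
   acts on the tensor factors of indices [i] and [i+1], counted from 0. *)
Definition act k (f : tpow 2 -> tpow 2) (i : 'I_k) (x : tpow k.+1) : tpow k.+1 :=
  plift (fun v : k.+1.-tuple A =>
    plift (fun w : 2.-tuple A =>
             pure (tset (tset v (inord i) (tnth w 0)) (inord i.+1) (tnth w 1)))
          (f (tens (tnth v (inord i)) (tnth v (inord i.+1))))) x.

Lemma tsetC n (v : n.-tuple A) i j a b : i != j ->
  tset (tset v i a) j b = tset (tset v j b) i a.
Proof.
move=> nij; apply: eq_from_tnth => l; rewrite !tnth_mktuple.
by case: eqP => [->|//]; rewrite eq_sym (negPf nij).
Qed.

Lemma inordS_neq k (i : 'I_k) : inord i != inord i.+1 :> 'I_k.+1.
Proof.
by rewrite -val_eqE /= !inordK ?ltnS ?(ltnW (ltn_ord i)) // neq_ltn ltnSn.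
Qed.

Lemma act_compat k (f : {linear tpow 2 -> tpow 2}) (i : 'I_k) :
  multilinear (fun v : k.+1.-tuple A =>
    plift (fun w : 2.-tuple A =>
             pure (tset (tset v (inord i) (tnth w 0)) (inord i.+1) (tnth w 1)))
          (f (tens (tnth v (inord i)) (tnth v (inord i.+1))))).
Proof.
set p : 'I_k.+1 := inord i; set q : 'I_k.+1 := inord i.+1.
have npq : p != q by exact: inordS_neq.
have lin2 v : linear (plift (R := @multilinear_rel 2)
    (fun w : 2.-tuple A => pure (tset (tset v p (tnth w 0)) q (tnth w 1)))).
  apply/plift_lin/multilinearP.
  apply: (@bilinearP _ (fun a b => pure (tset (tset v p a) q b))) => [b|a] c x y.
  - by rewrite !(tsetC _ _ _ npq) pure_multilinear.
  - by rewrite pure_multilinear.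
move=> v j c a b.
have [->{j}|njp] := eqVneq j p.
  rewrite !tnth_mktuple !eqxx [q == p]eq_sym (negPf npq) tens_linl linearP.
  have E x : (fun w : 2.-tuple A => pure (tset (tset (tset v p x) p (tnth w 0)) q (tnth w 1)))
     = (fun w => pure (tset (tset v p (tnth w 0)) q (tnth w 1))).
    by apply/funext => w; rewrite tset_tset.
  by rewrite !E lin2.
have [->{j njp}|njq] := eqVneq j q.
  rewrite !tnth_mktuple !eqxx (negPf npq) tens_linr linearP.
  have E x : (fun w : 2.-tuple A => pure (tset (tset (tset v q x) p (tnth w 0)) q (tnth w 1)))
     = (fun w => pure (tset (tset v p (tnth w 0)) q (tnth w 1))).
    by apply/funext => w; rewrite (tsetC _ _ _ npq) tset_tset (tsetC _ _ _ npq).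
  by rewrite !E lin2.
rewrite !tnth_mktuple ![_ == j]eq_sym (negPf njp) (negPf njq) -plift_linfun.
congr plift; apply/funext => w.
by rewrite !(tsetC _ _ _ njp) !(tsetC _ _ _ njq) pure_multilinear.
Qed.

Lemma act_lin k (f : {linear tpow 2 -> tpow 2}) (i : 'I_k) : linear (act f i).
Proof. exact/plift_lin/multilinearP/act_compat. Qed.

Lemma act_pure k (f : {linear tpow 2 -> tpow 2}) (i : 'I_k) v :
  act f i (pure v) =
  plift (fun w : 2.-tuple A =>
           pure (tset (tset v (inord i) (tnth w 0)) (inord i.+1) (tnth w 1)))
        (f (tens (tnth v (inord i)) (tnth v (inord i.+1)))).
Proof. exact/plift_gen/multilinearP/act_compat. Qed.

Lemma flip_compat : multilinear (fun w : 2.-tuple A => tens (tnth w 1) (tnth w 0)).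
Proof.
apply: (@bilinearP _ (fun a b => tens b a)) => [b|a].
- exact: tens_linr.
- exact: tens_linl.
Qed.

Lemma flip_lin : linear flip.
Proof. exact/plift_lin/multilinearP/flip_compat. Qed.

Lemma flip_tens a b : flip (tens a b) = tens b a.
Proof. by rewrite /flip plift_gen //; exact/multilinearP/flip_compat. Qed.

Definition lCEDS (Phi : {linear tpow 2 -> tpow 2}) : Prop :=
  let Phi_Id := act Phi (0 : 'I_2) in let Id_Phi := act Phi (1 : 'I_2) in
  let tau_Id := act flip (0 : 'I_2) in let Id_tau := act flip (1 : 'I_2) in
  Id_Phi \o Phi_Id \o Id_Phi =1 Phi_Id \o Id_tau \o Phi_Id /\
  Id_Phi \o Id_tau \o tau_Id \o Phi_Id =1 tau_Id \o Phi_Id \o Id_Phi \o Id_tau.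

(* (Id^(k-1) (x) f) o ... o (f (x) Id^(k-1)), the factor acting first on
   indices 0 and 1. *)
Definition act_chain k (f : tpow 2 -> tpow 2) (x : tpow k.+1) : tpow k.+1 :=
  foldl (fun y (i : 'I_k) => act f i y) x (enum 'I_k).

Lemma act_chain_lin k (f : {linear tpow 2 -> tpow 2}) : linear (@act_chain k f).
Proof.
rewrite /act_chain; elim: (enum _) => [|i r IH] c x y //=.
by rewrite act_lin IH.
Qed.

End TensorPower.

Arguments pure {K A n} v.
Arguments tens {K A} a b.
Arguments flip {K A}.

Inductive tree (A D : Type) : Type := Node of D & seq (A * tree A D).

HB.instance Definition _ A D := gen_eqMixin (tree A D).
HB.instance Definition _ A D := gen_choiceMixin (tree A D).

Lemma tree_nested_ind (A : eqType) (D : Type) (P : tree A D -> Prop) :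
  (forall d (s : seq (A * tree A D)), {in s, forall p, P p.2} -> P (Node d s)) ->
  forall t, P t.
Proof.
move=> PN; fix IH 1 => -[d s]; apply: PN.
elim: s => [p|[a t] s IHs p]; first by move=> {IH}; rewrite in_nil.
have := IH t => {IH} Pt.
by rewrite inE => /orP[/eqP -> //|]; exact: IHs.
Qed.

Section TypedTrees.
Variables (K : fieldType) (A : lmodType K) (D : Type).
Local Notation tree := (tree A D).

(* Trees are represented by planar ones, so the relations impose both linearity
   in the type of each edge and invariance under reordering the children of each
   vertex; [tree_rel_sub] propagates these relations to subtrees. *)
Inductive tree_rel : {freeg tree / K} -> Prop :=
| tree_rel_perm d s s' : perm_eq s s' -> tree_rel (<< Node d s >> - << Node d s' >>)
| tree_rel_lin d s1 s2 t c a b :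
    tree_rel (<< Node d (s1 ++ (c *: a + b, t) :: s2) >>
              - (c *: << Node d (s1 ++ (a, t) :: s2) >>
                 + << Node d (s1 ++ (b, t) :: s2) >>))
| tree_rel_sub d s1 s2 a r : tree_rel r ->
    tree_rel (fglift (fun t => << Node d (s1 ++ (a, t) :: s2) >>) r).

Definition trees := presented tree_rel.
HB.instance Definition _ := GRing.Lmodule.on trees.

Definition tree_class (t : tree) : trees := pgen t.

(* B_d(a_1 T_1, ..., a_k T_k) where all the T_i are trees, except one which is
   an arbitrary element [y] of [trees]. *)
Definition B (d : D) (s1 : seq (A * tree)) (a : A) (y : trees) (s2 : seq (A * tree)) : trees :=
  plift (fun t => tree_class (Node d (s1 ++ (a, t) :: s2))) y.

(* In the sum, [w] ranges over the pure tensors (a' -> a_i') (x) (a'' |> a_i'')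
   of Phi(a (x) a_i). *)
Fixpoint circ_tree (Phi : tpow A 2 -> tpow A 2) (x : trees) (t' : tree) (a : A) : trees :=
  let: Node d s := t' in
  let types := unzip1 s in
  let sub := [seq circ_tree Phi x p.2 | p <- s] in
  B d [::] a x s
  + \sum_(i < size s)
      plift (fun w : 2.-tuple A =>
               B d (take i s) (tnth w 0) (nth (fun=> 0) sub i (tnth w 1)) (drop i.+1 s))
            (Phi (tens a types`_i)).

Definition circ (Phi : tpow A 2 -> tpow A 2) (a : A) (x y : trees) : trees :=
  plift (fun t' => circ_tree Phi x t' a) y.

(* A vertex is given by its address: the list of the positions of the children
   to follow from the root. *)
Fixpoint vertices (t : tree) : seq (seq nat) :=
  let: Node _ s := t in
  let sub := [seq vertices p.2 | p <- s] in
  [::] :: [seq i :: x | i <- iota 0 (size s), x <- nth [::] sub i].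

Fixpoint path_types (t : tree) (x : seq nat) : seq A :=
  if x is i :: x' then
    let: Node _ s := t in
    if onth s i is Some (a, t') then a :: path_types t' x' else [::]
  else [::].

(* Grafts [t] on the vertex [x] of [t'], the successive elements of [w] being
   the new types of the edges on the path from the root to [x], followed by the
   type of the new edge. *)
Fixpoint graft (t t' : tree) (x : seq nat) (w : seq A) : tree :=
  let: Node d s := t' in
  if x is i :: x' then
    if onth s i is Some (_, t'') then
      Node d (take i s ++ (head 0 w, graft t t'' x' (behead w)) :: drop i.+1 s)
    else t'
  else Node d ((head 0 w, t) :: s).

Definition diamond (Phi : tpow A 2 -> tpow A 2) (a : A) (x : seq nat) (t t' : tree) : trees :=
  let types := path_types t' x in
  plift (fun w : (size types).+1.-tuple A => tree_class (graft t t' x w))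
        (act_chain Phi (pure (in_tuple (a :: types)))).

Lemma tree_class_perm d s s' :
  perm_eq s s' -> tree_class (Node d s) = tree_class (Node d s').
Proof.
move=> pss'; apply/eqP; rewrite -subr_eq0 -(linB (@pclass_lin _ _ _)).
by rewrite pclass_rel //; exact: tree_rel_perm.
Qed.

Lemma tree_class_lin d s1 s2 t : linear (fun a => tree_class (Node d (s1 ++ (a, t) :: s2))).
Proof.
move=> c a b; apply/eqP; rewrite -subr_eq0 -!pclass_lin -(linB (@pclass_lin _ _ _)).
by rewrite pclass_rel //; exact: tree_rel_lin.
Qed.

Lemma tree_class_sub d s1 s2 a :
  respects tree_rel (fun t => tree_class (Node d (s1 ++ (a, t) :: s2))).
Proof.
move=> r /(tree_rel_sub d s1 s2 a)/pclass_rel.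
by rewrite (fglift_comp _ _ (@pclass_lin _ _ _)).
Qed.

Lemma B_tree d s1 a t s2 :
  B d s1 a (tree_class t) s2 = tree_class (Node d (s1 ++ (a, t) :: s2)).
Proof. by rewrite /B plift_gen //; exact: tree_class_sub. Qed.

Lemma B_lin d s1 a s2 : linear (fun y => B d s1 a y s2).
Proof. exact/plift_lin/tree_class_sub. Qed.

Lemma B_type_lin d s1 y s2 : linear (fun a => B d s1 a y s2).
Proof.
move=> c a b; rewrite -plift_linfun; congr plift; apply/funext => t.
exact: tree_class_lin.
Qed.

Lemma perm_front (s1 s2 : seq (A * tree)) q : perm_eq (s1 ++ q :: s2) (q :: s1 ++ s2).
Proof. by rewrite (perm_catCA s1 [:: q]). Qed.

Lemma B_perm d s1 s2 s1' s2' a y :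
  perm_eq (s1 ++ s2) (s1' ++ s2') -> B d s1 a y s2 = B d s1' a y s2'.
Proof.
move=> p; congr plift; apply/funext => t; apply: tree_class_perm.
by rewrite (permPl (perm_front _ _ _)) (permPr (perm_front _ _ _)) perm_cons.
Qed.

Section Circ.
Variable Phi : {linear tpow A 2 -> tpow A 2}.

Lemma circ_treeE x d s a p0 :
  circ_tree Phi x (Node d s) a = B d [::] a x s +
  \sum_(i < size s) plift
    (fun w : 2.-tuple A => B d (take i s) (tnth w 0)
        (circ_tree Phi x (nth p0 s i).2 (tnth w 1)) (drop i.+1 s))
    (Phi (tens a (nth p0 s i).1)).
Proof.
rewrite /=; congr (_ + _); apply: eq_bigr => i _.
by rewrite (nth_map p0) // (nth_map p0).
Qed.

Lemma circ_tree_compat x t d s1 s2 : linear (circ_tree Phi x t) ->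
  respects (@multilinear_rel K A 2)
    (fun w : 2.-tuple A => B d s1 (tnth w 0) (circ_tree Phi x t (tnth w 1)) s2).
Proof.
move=> lt; apply/multilinearP.
apply: (@bilinearP _ _ _ (fun a b => B d s1 a (circ_tree Phi x t b) s2)) => [b|a c u v].
- exact: B_type_lin.
- by rewrite lt B_lin.
Qed.

Lemma circ_tree_lin x t : linear (circ_tree Phi x t).
Proof.
elim/tree_nested_ind: t => d s IH c a b; pose p0 : A * tree := (0, Node d s).
rewrite !(circ_treeE _ _ _ _ p0) B_type_lin scalerDr addrACA; congr (_ + _).
rewrite scaler_sumr -big_split; apply: eq_bigr => i _ /=.
rewrite tens_linl linearP plift_lin //.
by apply: circ_tree_compat; apply: IH; exact: mem_nth.
Qed.

Lemma circ_tree_rem x d s a : circ_tree Phi x (Node d s) a = B d [::] a x s +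
  \sum_(p <- s) plift
    (fun w : 2.-tuple A => B d [::] (tnth w 0)
        (circ_tree Phi x p.2 (tnth w 1)) (rem p s)) (Phi (tens a p.1)).
Proof.
pose p0 : A * tree := (0, Node d s).
rewrite (circ_treeE _ _ _ _ p0) (big_nth p0) big_mkord; congr (_ + _).
apply: eq_bigr => i _; congr plift; apply/funext => w; apply: B_perm => /=.
rewrite -(perm_cons (nth p0 s i)) -(permPl (perm_front _ _ _)) -drop_nth //.
by rewrite cat_take_drop perm_to_rem ?mem_nth.
Qed.

Lemma circ_tree_perm x d s s' a : perm_eq s s' ->
  circ_tree Phi x (Node d s) a = circ_tree Phi x (Node d s') a.
Proof.
move=> p; rewrite !circ_tree_rem; congr (_ + _); first exact: B_perm.
rewrite (perm_big _ p) /= big_seq [RHS]big_seq; apply: eq_bigr => q qs.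
congr plift; apply/funext => w; apply: B_perm => /=.
rewrite -(perm_cons q) -(permPr (perm_to_rem qs)) -(permPr p) perm_sym.
by rewrite perm_to_rem // (perm_mem p).
Qed.

Lemma circ_tree_cons x d q s a p0 : circ_tree Phi x (Node d (q :: s)) a =
  B d [:: q] a x s +
  (plift (fun w : 2.-tuple A =>
      B d [::] (tnth w 0) (circ_tree Phi x q.2 (tnth w 1)) s) (Phi (tens a q.1)) +
   \sum_(i < size s) plift (fun w : 2.-tuple A =>
      B d (q :: take i s) (tnth w 0)
        (circ_tree Phi x (nth p0 s i).2 (tnth w 1)) (drop i.+1 s))
      (Phi (tens a (nth p0 s i).1))).
Proof.
rewrite (circ_treeE _ _ _ _ p0) /= big_ord_recl /= drop0.
by rewrite (@B_perm d [::] (q :: s) [:: q] s).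
Qed.

Lemma B_edge_lin d s1 s1' s2 t b y :
  linear (fun a => B d (s1 ++ (a, t) :: s1') b y s2).
Proof.
move=> c u v; rewrite -plift_linfun; congr plift; apply/funext => t'.
by rewrite -!catA !cat_cons tree_class_lin.
Qed.

Lemma B_sub d s1 s1' s2 a b y r : tree_rel r ->
  fglift (fun t => B d (s1 ++ (a, t) :: s1') b y s2) r = 0.
Proof.
move=> Rr; elim/presented_ind: y => [|c u y IH].
  under eq_fun do rewrite (lin0 (B_lin _ _ _ _)).
  by have := fglift_linfun (-1) (fun=> 0 : trees) (fun=> 0) r;
     rewrite scaler0 add0r scaleN1r addNr.
under eq_fun do rewrite (B_lin _ _ _ _).
rewrite fglift_linfun IH addr0.
under eq_fun do rewrite -[pgen u]/(tree_class u) B_tree -catA cat_cons.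
by rewrite tree_class_sub // scaler0.
Qed.

Lemma fglift_swap (X Y : choiceType) (V : lmodType K) (S : {freeg Y / K} -> Prop)
    (F : X -> Y -> V) (r : {freeg X / K}) (z : presented S) :
  fglift (fun t => plift (F t) z) r = plift (fun w => fglift (F^~ w) r) z.
Proof.
elim/free_ind: r => [|c x r IH].
  under [in RHS]eq_fun do rewrite (lin0 (fglift_lin _)).
  rewrite (lin0 (fglift_lin _)).
  have := plift_linfun (-1) (fun=> 0 : V) (fun=> 0) z.
  by under eq_fun do rewrite scaler0 add0r; rewrite scaleN1r addNr.
rewrite fglift_lin fglift_gen IH -plift_linfun; congr plift; apply/funext => w.
by rewrite fglift_lin fglift_gen.
Qed.

Lemma fglift0 (X : choiceType) (V : lmodType K) (r : {freeg X / K}) :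
  fglift (fun=> 0 : V) r = 0.
Proof.
have := fglift_linfun (-1) (fun=> 0 : V) (fun=> 0) r.
by under eq_fun do rewrite scaler0 add0r; rewrite scaleN1r addNr.
Qed.

Lemma fgliftD (X : choiceType) (V : lmodType K) (f h : X -> V) r :
  fglift (fun x => f x + h x) r = fglift f r + fglift h r.
Proof.
rewrite -[fglift f r]scale1r -fglift_linfun; congr fglift.
by apply/funext => x; rewrite scale1r.
Qed.

Lemma fglift_sum (X : choiceType) (V : lmodType K) n (f : 'I_n -> X -> V) r :
  fglift (fun x => \sum_i f i x) r = \sum_i fglift (f i) r.
Proof.
elim: n => [|n IH] in f *.
  by under eq_fun do rewrite big_ord0; rewrite big_ord0 fglift0.
under eq_fun do rewrite big_ord_recl.
by rewrite fgliftD IH big_ord_recl.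
Qed.

Lemma circ_tree_respects x a : respects tree_rel (fun t => circ_tree Phi x t a).
Proof.
move=> r Rr; elim: Rr a => {r} [d s s' p|d s1 s2 t c u v|d s1 s2 b r Rr IH] a.
- rewrite (linB (fglift_lin _)) !fglift_gen; apply/eqP; rewrite subr_eq0; apply/eqP.
  exact: circ_tree_perm.
- rewrite (linB (fglift_lin _)) fglift_lin !fglift_gen.
  apply/eqP; rewrite subr_eq0; apply/eqP.
  rewrite !(circ_tree_perm _ _ _ (perm_front _ _ _)).
  pose p0 : A * tree := (0, t); set s := s1 ++ s2.
  rewrite !(circ_tree_cons _ _ _ _ _ p0) /= !scalerDr.
  rewrite [RHS]addrACA; congr (_ + _).
    exact: (B_edge_lin d [::] [::] s).
  rewrite [RHS]addrACA; congr (_ + _).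
    by rewrite tens_linr linearP plift_lin //; exact/circ_tree_compat/circ_tree_lin.
  rewrite scaler_sumr -big_split; apply: eq_bigr => i _ /=.
  rewrite -plift_linfun; congr plift; apply/funext => w.
  exact: (B_edge_lin d [::] (take i s)).
- rewrite (fglift_comp _ _ (fglift_lin _)).
  pose s := s1 ++ s2; pose p0 : A * tree := (0, Node d s).
  under eq_fun do rewrite fglift_gen (circ_tree_perm _ _ _ (perm_front _ _ _)).
  under eq_fun do rewrite (circ_tree_cons _ _ _ _ _ p0) /=.
  rewrite !fgliftD fglift_sum (B_sub _ [::] [::]) // add0r.
  rewrite [X in X + _](_ : _ = 0); last first.
    rewrite fglift_swap -[RHS](fglift0 _ (repr (Phi (tens a b)))).
    congr fglift; apply/funext => w.
    by rewrite -(fglift_comp _ _ (B_lin _ _ _ _)) IH (lin0 (B_lin _ _ _ _)).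
  rewrite add0r big1 // => i _.
  rewrite fglift_swap -[RHS](fglift0 _ (repr (Phi (tens a (nth p0 s i).1)))).
  congr fglift; apply/funext => w.
  by rewrite (B_sub d [::] (take i s)).
Qed.

Lemma circ_gen a x t : circ Phi a x (tree_class t) = circ_tree Phi x t a.
Proof. by rewrite /circ plift_gen //; exact: circ_tree_respects. Qed.

Lemma circ_linr a x : linear (circ Phi a x).
Proof. exact/plift_lin/circ_tree_respects. Qed.

Lemma circ_lin_type x y : linear (fun a => circ Phi a x y).
Proof.
move=> c a b; rewrite /circ -plift_linfun; congr plift; apply/funext => t.
by rewrite circ_tree_lin.
Qed.

Lemma circ_linl a y : linear (fun x => circ Phi a x y).
Proof.
move=> c x x'; rewrite /circ -plift_linfun; congr plift; apply/funext => t.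
elim/tree_nested_ind: t a => d s IH a; pose p0 : A * tree := (0, Node d s).
rewrite !(circ_treeE _ _ _ _ p0) B_lin scalerDr [RHS]addrACA; congr (_ + _).
rewrite scaler_sumr -big_split; apply: eq_bigr => i _ /=.
rewrite -plift_linfun; congr plift; apply/funext => w.
by rewrite IH ?mem_nth // B_lin.
Qed.

Lemma circ_Node a x d s p0 : circ Phi a x (tree_class (Node d s)) =
  B d [::] a x s +
  \sum_(i < size s) plift
    (fun w : 2.-tuple A => B d (take i s) (tnth w 0)
        (circ Phi (tnth w 1) x (tree_class (nth p0 s i).2)) (drop i.+1 s))
    (Phi (tens a (nth p0 s i).1)).
Proof.
rewrite circ_gen (circ_treeE _ _ _ _ p0); congr (_ + _).
apply: eq_bigr => i _; congr plift; apply/funext => w.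
by rewrite circ_gen.
Qed.

Lemma circ_Node_compat x y d s1 s2 : respects (@multilinear_rel K A 2)
  (fun w : 2.-tuple A => B d s1 (tnth w 0) (circ Phi (tnth w 1) x y) s2).
Proof.
apply/multilinearP.
apply: (@bilinearP _ _ _ (fun a b => B d s1 a (circ Phi b x y) s2)) => [b|a c u v].
- exact: B_type_lin.
- by rewrite circ_lin_type B_lin.
Qed.

End Circ.

Lemma vertices_Node d s p0 : vertices (Node d s : tree) =
  [::] :: [seq i :: x | i <- iota 0 (size s), x <- vertices (nth p0 s i).2].
Proof.
rewrite /=; congr (_ :: flatten _); apply/eq_in_map => i.
by rewrite mem_iota => /andP[_ lti]; rewrite (nth_map p0).
Qed.

Lemma uniq_vertices (t : tree) : uniq (vertices t).
Proof.
elim/tree_nested_ind: t => d s IH; pose p0 : A * tree := (0, Node d s).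
rewrite (vertices_Node _ _ p0) /=; apply/andP; split.
  by apply/negP => /allpairsPdep[i [x []]].
apply: allpairs_uniq_dep; first exact: iota_uniq.
  by move=> i; rewrite mem_iota => /andP[_ lti]; apply: IH; exact: mem_nth.
by move=> [i x] [j y] _ _ /= [-> ->].
Qed.

Lemma mem_vertices_cons d s p0 i x : (i :: x \in vertices (Node d s : tree)) =
  (i < size s)%N && (x \in vertices (nth p0 s i).2).
Proof.
rewrite (vertices_Node _ _ p0) inE /=; apply/allpairsPdep/andP => [[j [y []]]|[lti xi]].
  by rewrite mem_iota => /andP[_ lti] yj [-> ->].
by exists i, x; rewrite mem_iota.
Qed.

Lemma val_tset n (v : n.-tuple A) i a : tset v i a = take i v ++ a :: drop i.+1 v :> seq A.
Proof.
have si : size (take i v) = i by rewrite size_take size_tuple ltn_ord.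
apply: (@eq_from_nth _ 0) => [|j].
  by rewrite size_cat /= si size_drop !size_tuple card_ord addnS -addSn subnKC.
rewrite size_tuple ?card_ord => ltj; rewrite -(tnth_nth 0 _ (Ordinal ltj)) tnth_mktuple.
rewrite nth_cat si -val_eqE /= (tnth_nth 0) /=.
case: ltngtP => [ltji|ltij|->]; first by rewrite nth_take.
  by rewrite -[(j - i)%N]prednK ?subn_gt0 //= nth_drop -subnS subnKC.
by rewrite subnn.
Qed.

Lemma graft_lin t t' x (w1 w2 : seq A) :
  x \in vertices t' -> (size w1 + size w2)%N = size (path_types t' x) ->
  linear (fun a => tree_class (graft t t' x (w1 ++ a :: w2))).
Proof.
elim: x t' w1 => [|i x IH] [d s] w1.
  move=> _ /eqP; rewrite addn_eq0 !size_eq0 => /andP[/eqP -> /eqP ->].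
  exact: (tree_class_lin d [::] s).
pose p0 : A * tree := (0, Node d s).
rewrite (mem_vertices_cons _ _ p0) => /andP[lti xV] /=.
have -> : onth s i = Some (nth p0 s i) by rewrite (onthE s) (nth_map p0).
case: (nth p0 s i) xV => b t'' /= xV.
case: w1 => [_|b' w1 /= [szw]].
  exact: (tree_class_lin d (take i s) (drop i.+1 s) (graft t t'' x w2)).
by move=> c u v; rewrite -!B_tree IH // B_lin.
Qed.

Lemma diamond_compat t t' x : x \in vertices t' -> respects
  (@multilinear_rel K A (size (path_types t' x)).+1)
  (fun w : (size (path_types t' x)).+1.-tuple A => tree_class (graft t t' x w)).
Proof.
move=> xV; apply/multilinearP => v i c a b; rewrite !val_tset graft_lin //.
rewrite size_take size_drop size_tuple ltn_ord subSS subnKC //.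
by rewrite -ltnS.
Qed.

End TypedTrees.

(* Main.v *)
Require Import Defs.
From mathcomp Require Import freeg boolp.
From mathcomp Require Import all_boot all_algebra.

Set Implicit Arguments.
Unset Strict Implicit.
Unset Printing Implicit Defensive.

Import GRing.Theory.
Local Open Scope ring_scope.

(** Both sides satisfy the same recursion on [T']. The operator acting first in
    the composition defining [diamond] involves only the types of the new edge
    and of the edge leaving the root; expanding it as a sum of pure tensors
    [b (x) c], the type [b] stays on the edge leaving the root and the remaining
    operators compute the [c]-diamond in the subtree below that edge. *)

Section Linearity.
Variable K : fieldType.

Lemma lin_sum (U V : lmodType K) (f : U -> V) (I : Type) (r : seq I) (F : I -> U) :
  linear f -> f (\sum_(i <- r) F i) = \sum_(i <- r) f (F i).
Proof. by move=> lf; apply: (big_morph f (linD lf) (lin0 lf)). Qed.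

(** [plift] evaluates at the representative [repr z], the same for all functions, so a sum of
    functions passes through it termwise. *)
Lemma plift_sum (X : choiceType) (R : {freeg X / K} -> Prop) (V : lmodType K)
    (I : Type) (r : seq I) (F : I -> X -> V) (z : presented R) :
  plift (fun x => \sum_(i <- r) F i x) z = \sum_(i <- r) plift (F i) z.
Proof.
elim: r => [|i r IH].
  rewrite big_nil; under eq_fun do rewrite big_nil.
  exact: fglift0.
rewrite big_cons -IH; under eq_fun do rewrite big_cons.
exact: fgliftD.
Qed.

End Linearity.

Section TensorCons.
Variables (K : fieldType) (A : lmodType K).

Lemma tset_cons0 n (v : n.-tuple A) c e :
  tset (cons_tuple c v) ord0 e = cons_tuple e v.
Proof.
apply: eq_from_tnth => j; rewrite tnth_mktuple.
by case: (unliftP ord0 j) => [l|] ->; rewrite ?tnthS ?tnth0.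
Qed.

Lemma tset_consS n (v : n.-tuple A) c j e :
  tset (cons_tuple c v) (lift ord0 j) e = cons_tuple c (tset v j e).
Proof.
apply: eq_from_tnth => l; rewrite tnth_mktuple.
case: (unliftP ord0 l) => [m|] -> ; last by rewrite !tnth0.
by rewrite !tnthS tnth_mktuple (inj_eq lift_inj).
Qed.

(** Tensoring with [c] on the left: in the recursion, [c] is the final type of the edge leaving the
    root. *)
Definition tcons n (c : A) (x : tpow A n) : tpow A n.+1 :=
  plift (fun v : n.-tuple A => pure (cons_tuple c v)) x.

Lemma tcons_compat n c :
  respects (@multilinear_rel K A n) (fun v => pure (cons_tuple c v)).
Proof. by apply/multilinearP => v i k a b; rewrite -!tset_consS pure_multilinear. Qed.

Lemma tcons_lin n c : linear (@tcons n c).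
Proof. exact/plift_lin/tcons_compat. Qed.

Lemma tcons_pure n c (v : n.-tuple A) : tcons c (pure v) = pure (cons_tuple c v).
Proof. exact/plift_gen/tcons_compat. Qed.

Lemma plift_tcons n (V : lmodType K) (g : n.+1.-tuple A -> V) c (x : tpow A n) :
  respects (@multilinear_rel K A n.+1) g ->
  plift g (tcons c x) = plift (fun v => g (cons_tuple c v)) x.
Proof.
move=> rg; rewrite (plift_comp _ _ (plift_lin rg)).
by congr plift; apply/funext => v; rewrite plift_gen.
Qed.

(** Bridges the [inord] indices used by [act] and the [lift ord0] indices produced by
    [enum_ordSl]. *)
Lemma inord_liftS k (i : 'I_k.+1) : inord i.+1 = lift ord0 i :> 'I_k.+2.
Proof. by apply: val_inj; rewrite /= inordK // ltnS. Qed.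

Variable Phi : {linear tpow A 2 -> tpow A 2}.

(** An operator at a shifted index never touches factor 0. Both sides are linear in [x], so pure
    tensors suffice. *)
Lemma act_tcons k (i : 'I_k) c (x : tpow A k.+1) :
  act Phi (lift ord0 i) (tcons c x) = tcons c (act Phi i x).
Proof.
have lact m (j : 'I_m) : linear (act Phi j) by exact: act_lin.
apply: (@eq_lin _ _ _ _ (fun x => act Phi _ (tcons c x)) (fun x => tcons c (act Phi i x))) x.
- by move=> b u v; rewrite tcons_lin lact.
- by move=> b u v; rewrite lact tcons_lin.
move=> v; rewrite -/(pure v) tcons_pure !act_pure (plift_comp _ _ (@tcons_lin _ c)) /=.
have E j : (j < k.+1)%N -> inord j.+1 = lift ord0 (inord j) :> 'I_k.+2.
  by move=> ltj; rewrite -inord_liftS inordK.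
have -> : bump 0 i = i.+1 by [].
rewrite !E ?ltnS // ?(ltnW (ltn_ord i)) // !tnthS.
by congr plift; apply/funext => w; rewrite !tset_consS tcons_pure.
Qed.

(** The operator of index 0 acts first and turns [a], [b] into [Phi (tens a b)]. All later ones have
    positive index: they fix the first factor and form the shorter chain on the others. *)
Lemma act_chain_cons k a b (v : k.-tuple A) :
  act_chain Phi (pure (cons_tuple a (cons_tuple b v))) =
  plift (fun w : 2.-tuple A =>
      tcons (tnth w 0) (act_chain Phi (pure (cons_tuple (tnth w 1) v))))
    (Phi (tens a b)).
Proof.
(* Linearity of the remaining operators lets them act termwise on the expansion of
   [Phi (tens a b)]. *)
have lchain m (r : seq 'I_m) : linear (foldl (fun y i => act Phi i y) ^~ r).
  by elim: r => [|i r IH] c x y //=; rewrite act_lin IH.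
rewrite /act_chain enum_ordSl /= act_pure.
have -> : inord 0 = ord0 :> 'I_k.+2 by apply: val_inj; rewrite /= inordK.
rewrite (inord_liftS (ord0 : 'I_k.+1)) tnthS !tnth0.
rewrite (plift_comp _ _ (lchain _ _)); congr plift; apply/funext => w.
rewrite tset_cons0 tset_consS tset_cons0 -tcons_pure.
by elim: (enum 'I_k) (pure _) => [|i r IH] x //=; rewrite act_tcons IH.
Qed.

End TensorCons.

Section Diamond.
Variables (K : fieldType) (A : lmodType K) (D : Type).
Variable Phi : {linear tpow A 2 -> tpow A 2}.

Lemma diamond_root a (t : tree A D) d s :
  diamond Phi a [::] t (Node d s) = tree_class (Node d ((a, t) :: s)).
Proof.
rewrite /diamond /act_chain /=.
have -> : enum 'I_0 = [::] by apply: size0nil; rewrite size_enum_ord.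
by rewrite plift_gen //; apply: (@diamond_compat _ _ _ t (Node d s) [::]).
Qed.

Lemma diamond_child a (t : tree A D) d s p0 i x :
  i :: x \in vertices (Node d s) ->
  diamond Phi a (i :: x) t (Node d s) =
  plift (fun w : 2.-tuple A => B d (take i s) (tnth w 0)
      (diamond Phi (tnth w 1) x t (nth p0 s i).2) (drop i.+1 s))
    (Phi (tens a (nth p0 s i).1)).
Proof.
move=> ixV; have := ixV; rewrite (mem_vertices_cons _ _ p0) => /andP[lti _].
have Es : onth s i = Some (nth p0 s i) by rewrite (onthE s) (nth_map p0).
have Et : path_types (Node d s) (i :: x) =
    (nth p0 s i).1 :: path_types (nth p0 s i).2 x.
  by rewrite /= Es; case: (nth p0 s i).
have := @diamond_compat _ _ _ t _ _ ixV; rewrite /diamond.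
(* The length of the path occurs in the type of the tensor power, so the path is generalised,
   together with [compat], before being replaced. *)
move: (path_types (Node d s) (i :: x)) Et => _ -> compat.
set l := path_types _ x in compat *; set b := (nth p0 s i).1 in compat *.
have -> : in_tuple (a :: b :: l) = cons_tuple a (cons_tuple b (in_tuple l)).
  exact: val_inj.
rewrite act_chain_cons (plift_comp _ _ (plift_lin compat)).
congr plift; apply/funext => w; set c := tnth w 0; set e := tnth w 1.
have -> : in_tuple (e :: l) = cons_tuple e (in_tuple l) by exact: val_inj.
rewrite (plift_tcons _ _ compat) (plift_comp _ _ (B_lin d (take i s) c (drop i.+1 s))).
(* Grafting at [i :: x] gives the head [c] to the edge towards child [i] and hands [v] on to the
   subtree. *)
congr plift; apply/funext => v; rewrite B_tree /= Es.
by case: (nth p0 s i).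
Qed.

End Diamond.

Theorem proposition2p6 (K : fieldType) (charK : [pchar K] =i pred0)
    (A : lmodType K) (Phi : {linear tpow A 2 -> tpow A 2}) (D : Type)
    (T T' : tree A D) (a : A) :
  lCEDS Phi ->
  circ Phi a (tree_class T) (tree_class T')
    = \sum_(x <- vertices T') diamond Phi a x T T'.
Proof.
(* The type [a] varies in the induction, since the subtrees receive the second factors of [Phi]. The
   pair [p0] is only a default for [nth]. *)
move=> _; elim/tree_nested_ind: T' a => d s IH a; pose p0 : A * tree A D := (0, T).
rewrite (circ_Node _ _ _ _ _ p0) (vertices_Node _ _ p0) big_cons diamond_root B_tree.
congr (_ + _); rewrite big_allpairs_dep /=.
have -> : iota 0 (size s) = index_iota 0 (size s) by rewrite /index_iota subn0.
rewrite big_mkord.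
apply: eq_bigr => i _.
under eq_fun do rewrite IH ?mem_nth // (lin_sum _ _ (B_lin _ _ _ _)).
(* Membership [xV] is kept because [diamond_child] requires the address of an actual vertex. *)
rewrite plift_sum big_seq [RHS]big_seq; apply: eq_bigr => x xV.
by rewrite (diamond_child _ _ _ p0) // (mem_vertices_cons _ _ p0) ltn_ord.
Qed.
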